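(* Let $u\in(0,1)$ and $\mathscr{C}_n^u:=F^{-(n-1)}[u,1]$ for $n\ge1$. Then \[\sum_{k=0}^n\lambda(\mathscr{C}_{k+1}^u)=\frac{n\log(1/u)}{\log n}\left(1+O_u\!\left(\frac{1}{\log n}\right)\right)\qquad(n\to\infty).\]
   Context: $\lambda$ denotes Lebesgue measure on $[0,1]$. $F:[0,1]\to[0,1]$ is the Farey map, $F(x)=x/(1-x)$ for $0\le x\le 1/2$ and $F(x)=(1-x)/x$ for $1/2<x\le 1$; $F^{-k}$ denotes preimage under the $k$-th iterate. The implied constant depends only on $u$. *)

(* Defs.v *)
From Stdlib Require Import Reals Lra.
Open Scope R_scope.

Definition farey (x : R) : R :=
  if Rle_dec x (1/2) then x / (1 - x) else (1 - x) / x.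

Definition farey_iter (k : nat) (x : R) : R := Nat.iter k farey x.

Definition farey_preim (k : nat) (u : R) : R -> Prop :=
  fun x => 0 <= x <= 1 /\ u <= farey_iter k x <= 1.

Definition interval_cover (A : R -> Prop) (s : R) : Prop :=
  exists a b : nat -> R,
    (forall i, a i <= b i) /\
    (forall x, A x -> exists i, a i < x < b i) /\
    Un_cv (fun N => sum_f_R0 (fun i => b i - a i) N) s.

Definition lebesgue_measure_is (A : R -> Prop) (m : R) : Prop :=
  (forall s, interval_cover A s -> m <= s) /\
  (forall m', (forall s, interval_cover A s -> m' <= s) -> m' <= m).

(* Main.v *)
(* Write lambda(F^{-k}[u,1]) = int_u^1 w_k(x)/x dx with w_0(x) = x and w_{k+1} = T w_k, where T is the
   transfer operator of F with respect to dx/x. T preserves increasing concave functions, so every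
   w_k lies between w_{k+1}(1) = w_k(1/2) and w_k(1) on [1/2,1], and c_k = w_k(1) is decreasing.
   Decomposing the unit mass at time n by the last visit to [1/2,1] gives
     sum_{k<n} lambda(F^{-k}[1-1/(n-k+1), 1]) = 1 - 1/(n+1),
   hence the renewal inequalities
     sum_{k<n} c_{k+1} log((n-k+1)/(n-k)) <= 1 - 1/(n+1) <= sum_{k<n} c_k log((n-k+1)/(n-k)).
   Summing over n and using Chebyshev's sum inequality (both factors are decreasing in k) yields
   sum_{k<=n} c_k = n/log n + O(n/log^2 n). Finally sum_k (w_k(1) - w_k(x)) is bounded for each fixed
   x in (0,1], so w_k may be replaced by the constant c_k on [u,1]. *)
Require Import Defs.
From Stdlib Require Import Reals.
From Stdlib Require Import Lra Lia Classical.
From Coquelicot Require Import Coquelicot.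
From Stdlib Require Import List.
Open Scope R_scope.

(** * Preliminaries on derivatives and the inverse branches *)

Lemma derive_nonneg_le (f df : R -> R) (a b : R) :
  a <= b ->
  (forall x, a <= x <= b -> is_derive f x (df x) /\ 0 <= df x) ->
  f a <= f b.
Proof.
  intros Hab H.
  destruct (MVT_gen f a b df) as (c & Hc & Heq).
  - intros x Hx. rewrite Rmin_left, Rmax_right in Hx by lra. apply H; lra.
  - intros x Hx. rewrite Rmin_left, Rmax_right in Hx by lra.
    apply derivable_continuous_pt. exists (df x).
    apply is_derive_Reals, H; lra.
  - rewrite Rmin_left, Rmax_right in Hc by lra.
    destruct (H c Hc) as [_ H0].
    assert (0 <= df c * (b - a)) by (apply Rmult_le_pos; lra). lra.
Qed.

(* [auto_derive] produces eta-expanded [Derive] terms, which [rewrite] does not identify. *)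
Lemma Derive_eta_unique (f : R -> R) (x l : R) :
  is_derive f x l -> Derive (fun t => f t) x = l.
Proof. exact (is_derive_unique f x l). Qed.

Lemma branch_bounds (x : R) :
  0 <= x <= 1 ->
  0 <= x / (1 + x) <= 1 / (1 + x) /\ 1 / (1 + x) <= 1.
Proof.
  intros Hx.
  assert (0 < / (1 + x)) by (apply Rinv_0_lt_compat; lra).
  assert ((1 + x) * / (1 + x) = 1) by (field; lra).
  unfold Rdiv. nra.
Qed.

(** * The transfer operator *)

(* The transfer operator of [farey] acting on densities with respect to the invariant measure dx/x. *)
Definition farey_op (W : R -> R) (x : R) : R :=
  (W (x / (1 + x)) + x * W (1 / (1 + x))) / (1 + x).

(** Both derivatives are exhibited, so that stability under [farey_op] becomes a sign check on
    explicit formulas. *)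
Definition increasing_concave (W : R -> R) : Prop :=
  exists V Z : R -> R, forall x, 0 <= x <= 1 ->
    is_derive W x (V x) /\ is_derive V x (Z x) /\ 0 <= V x /\ Z x <= 0.

Lemma increasing_concave_le (W : R -> R) (x y : R) :
  increasing_concave W -> 0 <= x -> x <= y -> y <= 1 -> W x <= W y.
Proof.
  intros (V & Z & H) Hx Hxy Hy.
  apply (derive_nonneg_le W V); [lra|].
  intros t Ht. split; apply H; lra.
Qed.

Lemma increasing_concave_id : increasing_concave (fun x => x).
Proof.
  exists (fun _ => 1), (fun _ => 0). intros x _.
  refine (conj _ (conj _ (conj _ _))); try lra; auto_derive; auto.
Qed.

(** The witnesses are the derivatives of [farey_op W]. Since x/(1+x) <= 1/(1+x), [W] is larger and
    [V] smaller at the second point; with x <= 1 this fixes the sign of every term. *)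
Lemma increasing_concave_farey_op (W : R -> R) :
  increasing_concave W -> increasing_concave (farey_op W).
Proof.
  intros HW. pose proof (increasing_concave_le W) as Wmono.
  pose proof HW as (V & Z & H).
  exists (fun x => (V (x / (1 + x)) - x * V (1 / (1 + x))) / (1 + x) ^ 3
                   + (W (1 / (1 + x)) - W (x / (1 + x))) / (1 + x) ^ 2).
  exists (fun x => (Z (x / (1 + x)) + x * Z (1 / (1 + x))) / (1 + x) ^ 5
                   - (4 * V (x / (1 + x)) + (2 - 2 * x) * V (1 / (1 + x))) / (1 + x) ^ 4
                   - 2 * (W (1 / (1 + x)) - W (x / (1 + x))) / (1 + x) ^ 3).
  intros x Hx.
  destruct (branch_bounds x Hx) as [[B1 B2] B3].
  destruct (H (x / (1 + x))) as (W1 & V1 & P1 & N1); [lra|].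
  destruct (H (1 / (1 + x))) as (W2 & V2 & P2 & N2); [lra|].
  assert (HVd : V (1 / (1 + x)) <= V (x / (1 + x))).
  { apply Ropp_le_cancel.
    apply (derive_nonneg_le (fun t => - V t) (fun t => - Z t)); [lra|].
    intros t Ht. destruct (H t) as (_ & Vt & _ & Nt); [lra|].
    split; [|lra]. apply (is_derive_opp V t (Z t) Vt). }
  assert (HWd : W (x / (1 + x)) <= W (1 / (1 + x))) by (apply Wmono; auto; lra).
  assert (Hp : forall n, 0 < (1 + x) ^ n) by (intros n; apply pow_lt; lra).
  refine (conj _ (conj _ (conj _ _))).
  - unfold farey_op. auto_derive.
    + repeat split; try (eexists; eassumption); lra.
    + change (1 * / (1 + x)) with (1 / (1 + x)).
      change (x * / (1 + x)) with (x / (1 + x)).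
      rewrite (Derive_eta_unique _ _ _ W1), (Derive_eta_unique _ _ _ W2).
      field; lra.
  - auto_derive.
    + repeat split; try (eexists; eassumption); try lra.
      * apply (pow_nonzero (1 + x) 3); lra.
      * apply (pow_nonzero (1 + x) 2); lra.
    + change (1 * / (1 + x)) with (1 / (1 + x)).
      change (x * / (1 + x)) with (x / (1 + x)).
      rewrite (Derive_eta_unique _ _ _ W1), (Derive_eta_unique _ _ _ W2).
      rewrite (Derive_eta_unique _ _ _ V1), (Derive_eta_unique _ _ _ V2).
      field; lra.
  - apply Rplus_le_le_0_compat; apply Rdiv_le_0_compat; auto; nra.
  - assert (0 <= - (Z (x / (1 + x)) + x * Z (1 / (1 + x))) / (1 + x) ^ 5)
      by (apply Rdiv_le_0_compat; auto; nra).
    assert (0 <= (4 * V (x / (1 + x)) + (2 - 2 * x) * V (1 / (1 + x))) / (1 + x) ^ 4)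
      by (apply Rdiv_le_0_compat; auto; nra).
    assert (0 <= 2 * (W (1 / (1 + x)) - W (x / (1 + x))) / (1 + x) ^ 3)
      by (apply Rdiv_le_0_compat; auto; nra).
    unfold Rdiv in *. lra.
Qed.

(** Density with respect to dx/x of the image of Lebesgue measure under the [k]-th iterate; the
    initial function is the identity because dx = x dx/x. *)
Definition density (k : nat) : R -> R := Nat.iter k farey_op (fun x => x).

Lemma density_increasing_concave (k : nat) : increasing_concave (density k).
Proof.
  induction k as [|k IH].
  - exact increasing_concave_id.
  - exact (increasing_concave_farey_op _ IH).
Qed.

Lemma density_le (k : nat) (x y : R) :
  0 <= x -> x <= y -> y <= 1 -> density k x <= density k y.
Proof. apply increasing_concave_le, density_increasing_concave. Qed.

Lemma density_0 (k : nat) : density k 0 = 0.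
Proof.
  induction k as [|k IH]; [reflexivity|].
  change (density (S k) 0) with (farey_op (density k) 0). unfold farey_op.
  replace (0 / (1 + 0)) with 0 by field. rewrite IH. field.
Qed.

Lemma density_nonneg (k : nat) (x : R) : 0 <= x <= 1 -> 0 <= density k x.
Proof. intros Hx. rewrite <- (density_0 k). apply density_le; lra. Qed.

(** Both inverse branches send 1 to 1/2. Hence the next value at 1 bounds [density k] from below on
    [1/2,1]. *)
Lemma density_S_1 (k : nat) : density (S k) 1 = density k (1 / 2).
Proof.
  change (density (S k) 1) with (farey_op (density k) 1). unfold farey_op.
  replace (1 + 1) with 2 by ring. field.
Qed.

Lemma density_1_antitone (i j : nat) : (i <= j)%nat -> density j 1 <= density i 1.
Proof.
  induction 1 as [|j _ IH]; [lra|].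
  rewrite density_S_1. assert (density j (1 / 2) <= density j 1) by (apply density_le; lra).
  lra.
Qed.

(** * The distribution function *)

(* [tail k u] turns out to be the measure of [farey_preim k u]; the recursion reads
   F^{-1}[u,1] = [u/(1+u), 1/(1+u)]. *)
Fixpoint tail (k : nat) (u : R) : R :=
  match k with
  | O => 1 - u
  | S k => tail k (u / (1 + u)) - tail k (1 / (1 + u))
  end.

Lemma tail_1 (k : nat) : tail k 1 = 0.
Proof. destruct k; simpl; [ring|]. apply Rminus_diag_eq; f_equal; field. Qed.

Lemma tail_0 (k : nat) : tail k 0 = 1.
Proof.
  induction k as [|k IH]; simpl; [ring|].
  replace (0 / (1 + 0)) with 0 by field. replace (1 / (1 + 0)) with 1 by field.
  rewrite IH, tail_1. ring.
Qed.

(** Differentiating the recursion of [tail] along the two inverse branches reproduces [farey_op]. *)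
Lemma is_derive_tail (k : nat) (x : R) :
  0 < x <= 1 -> is_derive (tail k) x (- (density k x / x)).
Proof.
  revert x. induction k as [|k IH]; intros x Hx.
  - change (is_derive (fun x => 1 - x) x (- (x / x))). auto_derive; [auto|]. field; lra.
  - change (is_derive (fun x => tail k (x / (1 + x)) - tail k (1 / (1 + x))) x
              (- (farey_op (density k) x / x))).
    destruct (branch_bounds x) as [[B1 B2] B3]; [lra|].
    assert (0 < x / (1 + x)) by (apply Rdiv_lt_0_compat; lra).
    pose proof (IH (x / (1 + x)) ltac:(lra)) as D1.
    pose proof (IH (1 / (1 + x)) ltac:(lra)) as D2.
    auto_derive.
    + repeat split; try (eexists; eassumption); lra.
    + change (1 * / (1 + x)) with (1 / (1 + x)).
      change (x * / (1 + x)) with (x / (1 + x)).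
      rewrite (Derive_eta_unique _ _ _ D1), (Derive_eta_unique _ _ _ D2).
      unfold farey_op. field; lra.
Qed.

Lemma is_derive_tail_plus_ln (k : nat) (c x : R) :
  0 < x <= 1 ->
  is_derive (fun x => tail k x + c * ln x) x ((c - density k x) / x).
Proof.
  intros Hx. pose proof (is_derive_tail k x Hx) as D.
  revert D. generalize (tail k). intros T D. auto_derive.
  - repeat split; [eexists; eassumption | lra].
  - rewrite (Derive_eta_unique _ _ _ D). field; lra.
Qed.

(** [tail k y] is the integral of [density k x / x] over [y,1], and the monotone density lies
    between its endpoint values. Integrals are avoided by comparing with a multiple of ln, both
    sides vanishing at 1. *)
Lemma tail_bounds (k : nat) (y : R) :
  0 < y <= 1 ->
  density k y * - ln y <= tail k y <= density k 1 * - ln y.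
Proof.
  intros Hy. split.
  - assert (H : - (tail k y + density k y * ln y) <= - (tail k 1 + density k y * ln 1)).
    { apply (derive_nonneg_le (fun x => - (tail k x + density k y * ln x))
               (fun x => - ((density k y - density k x) / x))); [lra|].
      intros x Hx. split.
      - exact (is_derive_opp _ _ _ (is_derive_tail_plus_ln k (density k y) x ltac:(lra))).
      - assert (density k y <= density k x) by (apply density_le; lra).
        assert (0 <= (density k x - density k y) / x) by (apply Rdiv_le_0_compat; lra).
        unfold Rdiv in *. lra. }
    rewrite tail_1, ln_1 in H. lra.
  - assert (H : tail k y + density k 1 * ln y <= tail k 1 + density k 1 * ln 1).
    { apply (derive_nonneg_le (fun x => tail k x + density k 1 * ln x)
               (fun x => (density k 1 - density k x) / x)); [lra|].
      intros x Hx. split.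
      - apply is_derive_tail_plus_ln; lra.
      - assert (density k x <= density k 1) by (apply density_le; lra).
        apply Rdiv_le_0_compat; lra. }
    rewrite tail_1, ln_1 in H. lra.
Qed.

(** * Outer measure of the preimages *)

Definition total_length (l : list (R * R)) : R :=
  fold_right (fun p s => snd p - fst p + s) 0 l.

(** Finite closed covers follow the preimage recursion exactly; passing to countable open covers
    then costs an arbitrarily small amount. *)
Definition list_cover (l : list (R * R)) (A : R -> Prop) : Prop :=
  Forall (fun p => fst p <= snd p) l /\
  forall x, A x -> exists p, In p l /\ fst p <= x <= snd p.

Lemma total_length_app (l1 l2 : list (R * R)) :
  total_length (l1 ++ l2) = total_length l1 + total_length l2.
Proof. induction l1 as [|p l1 IH]; simpl; [|rewrite IH]; ring. Qed.

Lemma list_cover_union (l1 l2 : list (R * R)) (A1 A2 B : R -> Prop) :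
  list_cover l1 A1 -> list_cover l2 A2 -> (forall x, B x -> A1 x \/ A2 x) ->
  list_cover (l1 ++ l2) B.
Proof.
  intros [L1 H1] [L2 H2] HB. split.
  - now apply Forall_app.
  - intros x Hx. destruct (HB x Hx) as [H|H].
    + destruct (H1 x H) as (p & Hp & Hi). exists p. rewrite in_app_iff. auto.
    + destruct (H2 x H) as (p & Hp & Hi). exists p. rewrite in_app_iff. auto.
Qed.

Lemma farey_bounds (x : R) : 0 <= x <= 1 -> 0 <= farey x <= 1.
Proof.
  intros Hx. unfold farey. destruct (Rle_dec x (1 / 2)) as [H|H].
  - split; [apply Rdiv_le_0_compat; lra|]. apply Rle_div_l; lra.
  - split; [apply Rdiv_le_0_compat; lra|]. apply Rle_div_l; lra.
Qed.

Lemma farey_iter_bounds (k : nat) (x : R) : 0 <= x <= 1 -> 0 <= farey_iter k x <= 1.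
Proof.
  intros Hx. induction k as [|k IH]; [exact Hx|]. exact (farey_bounds _ IH).
Qed.

(** The branch x/(1+x) is increasing and 1/(1+x) decreasing, so the endpoints swap on the right. *)
Lemma farey_preimage_interval (a b y : R) :
  0 <= a -> 0 <= y <= 1 -> a <= farey y <= b ->
  a / (1 + a) <= y <= b / (1 + b) \/ 1 / (1 + b) <= y <= 1 / (1 + a).
Proof.
  unfold farey. intros Ha Hy. destruct (Rle_dec y (1 / 2)) as [H|H]; intros [H1 H2].
  - left. assert (y = y / (1 - y) * (1 - y)) by (field; lra).
    assert (0 <= y / (1 - y)) by lra.
    split; [apply Rle_div_l | apply Rle_div_r]; nra.
  - right. assert (1 - y = (1 - y) / y * y) by (field; lra).
    split; [apply Rle_div_l | apply Rle_div_r]; nra.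
Qed.

(** The last application of [farey] is pulled back to two intervals, each covered by induction; the
    lengths add up by the recursion of [tail]. *)
Lemma list_cover_farey_preimage (k : nat) (a b : R) :
  0 <= a -> a <= b -> b <= 1 ->
  exists l, list_cover l (fun x => 0 <= x <= 1 /\ a <= farey_iter k x <= b) /\
            total_length l = tail k a - tail k b.
Proof.
  revert a b. induction k as [|k IH]; intros a b Ha Hab Hb.
  - exists ((a, b) :: nil). split; [split|].
    + constructor; simpl; auto.
    + intros x [_ Hx]. exists (a, b). split; [now left | exact Hx].
    + simpl. ring.
  - assert (Hm : a / (1 + a) <= b / (1 + b) /\ 1 / (1 + b) <= 1 / (1 + a)).
    { assert (0 < / (1 + a)) by (apply Rinv_0_lt_compat; lra).
      assert (/ (1 + b) <= / (1 + a)) by (apply Rinv_le_contravar; lra).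
      replace (a / (1 + a)) with (1 - / (1 + a)) by (field; lra).
      replace (b / (1 + b)) with (1 - / (1 + b)) by (field; lra).
      unfold Rdiv. lra. }
    destruct (branch_bounds a) as [[A1 A2] A3]; [lra|].
    destruct (branch_bounds b) as [[B1 B2] B3]; [lra|].
    destruct (IH (a / (1 + a)) (b / (1 + b))) as (l1 & C1 & T1); try lra.
    destruct (IH (1 / (1 + b)) (1 / (1 + a))) as (l2 & C2 & T2); try lra.
    exists (l1 ++ l2). split.
    + apply (list_cover_union _ _ _ _ _ C1 C2). intros x [Hx Hi].
      destruct (farey_preimage_interval a b (farey_iter k x)) as [H|H]; auto.
      now apply farey_iter_bounds.
    + rewrite total_length_app, T1, T2. simpl. ring.
Qed.

Lemma interval_cover_cons (A : R -> Prop) (s c d : R) :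
  c <= d -> interval_cover A s ->
  interval_cover (fun x => c < x < d \/ A x) (d - c + s).
Proof.
  intros Hcd (a & b & Hle & Hcov & Hcv).
  exists (fun i => match i with O => c | S j => a j end),
         (fun i => match i with O => d | S j => b j end).
  repeat split.
  - intros [|i]; auto.
  - intros x [H|H]; [now exists O|]. destruct (Hcov x H) as [i Hi]. now exists (S i).
  - apply is_lim_seq_Reals, is_lim_seq_incr_1.
    apply is_lim_seq_ext with (fun N => (d - c) + sum_f_R0 (fun i => b i - a i) N).
    + intros n. symmetry. rewrite decomp_sum by lia. reflexivity.
    + apply is_lim_seq_plus'; [apply is_lim_seq_const | now apply is_lim_seq_Reals].
Qed.

Lemma interval_cover_subset (A B : R -> Prop) (s : R) :
  (forall x, B x -> A x) -> interval_cover A s -> interval_cover B s.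
Proof. intros H (a & b & Hle & Hcov & Hcv). exists a, b. auto. Qed.

Lemma interval_cover_empty : interval_cover (fun _ => False) 0.
Proof.
  exists (fun _ => 0), (fun _ => 0). repeat split; try tauto; [intros; lra|].
  intros e He. exists O. intros n _. unfold Rdist.
  rewrite (sum_eq _ (fun _ => 0)) by (intros; ring).
  rewrite sum_cte, Rmult_0_l, Rminus_0_r, Rabs_R0. lra.
Qed.

Lemma interval_cover_list (l : list (R * R)) (A B : R -> Prop) (s eps : R) :
  0 < eps -> interval_cover A s -> list_cover l B ->
  interval_cover (fun x => A x \/ B x) (s + total_length l + eps).
Proof.
  intros He HA. revert B eps He. induction l as [|[c d] l IH]; intros B eps He [HL HB].
  (* The interval (0, eps) only brings the total length to the exact prescribed value. *)
  - apply interval_cover_subset with (fun x => 0 < x < eps \/ A x).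
    + intros x [H|H]; [auto|]. destruct (HB x H) as (p & [] & _).
    + simpl. replace (s + 0 + eps) with (eps - 0 + s) by ring.
      apply interval_cover_cons; [lra | exact HA].
  - inversion_clear HL as [|? ? Hcd HL']. simpl in Hcd.
    (* Widening by eps/4 on each side spends eps/2 and leaves eps/2 for the rest of the list. *)
    apply interval_cover_subset with
      (fun x => c - eps / 4 < x < d + eps / 4 \/
                (A x \/ exists p, In p l /\ fst p <= x <= snd p)).
    + intros x [H|H]; [auto|]. destruct (HB x H) as (p & [<-|Hp] & Hi).
      * left. simpl in Hi. lra.
      * right. right. now exists p.
    + simpl. replace (s + (d - c + total_length l) + eps)
        with (d + eps / 4 - (c - eps / 4) + (s + total_length l + eps / 2)) by field.
      apply interval_cover_cons; [lra|]. apply IH; [lra|]. split; auto.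
Qed.

Lemma sum_f_R0_nonneg_le (f : nat -> R) (m n : nat) :
  (forall i, 0 <= f i) -> (m <= n)%nat -> sum_f_R0 f m <= sum_f_R0 f n.
Proof.
  intros Hf. induction 1 as [|n _ IH]; simpl; [lra|]. specialize (Hf (S n)). lra.
Qed.

Lemma term_le_sum_f_R0 (f : nat -> R) (i n : nat) :
  (forall i, 0 <= f i) -> (i <= n)%nat -> f i <= sum_f_R0 f n.
Proof.
  intros Hf Hi. apply Rle_trans with (sum_f_R0 f i).
  - destruct i; simpl; [lra|]. pose proof (cond_pos_sum f i Hf). lra.
  - now apply sum_f_R0_nonneg_le.
Qed.

(* With [clamp i t] the point of [a i, b i] closest to [t], the covered length
   sum_i (clamp i t - clamp i 0) to the left of [t] increases at least as fast as [t]. *)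
Lemma interval_cover_unit (s : R) :
  interval_cover (fun x => 0 <= x <= 1) s -> 1 <= s.
Proof.
  intros (a & b & Hle & Hcov & Hcv).
  set (clamp := fun i t => Rmax (a i) (Rmin t (b i))).
  assert (Hmono : forall i t t', t <= t' -> 0 <= clamp i t' - clamp i t).
  { intros i t t' Ht. unfold clamp.
    assert (Rmin t (b i) <= Rmin t' (b i)) by (apply Rle_min_compat_r; lra).
    assert (Rmax (a i) (Rmin t (b i)) <= Rmax (a i) (Rmin t' (b i)))
      by (apply Rle_max_compat_l; lra). lra. }
  assert (Hinside : forall i t, a i < t -> t < b i -> clamp i t = t).
  { intros i t H1 H2. unfold clamp. rewrite Rmin_left, Rmax_right; lra. }
  set (E := fun t => 0 <= t <= 1 /\
                     exists N, t <= sum_f_R0 (fun i => clamp i t - clamp i 0) N).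
  assert (E0 : E 0).
  { split; [lra|]. exists O. simpl. lra. }
  destruct (completeness E) as [tau [Hub Hlub]].
  { exists 1. intros t [Ht _]. lra. }
  { now exists 0. }
  assert (Htau : 0 <= tau <= 1).
  { split; [now apply Hub|]. apply Hlub. intros t [Ht _]. lra. }
  destruct (Hcov tau Htau) as [i Hi].
  destruct (classic (exists t, E t /\ a i < t)) as [(t & Et & Hat) | Hno].
  2:{ assert (tau <= a i); [|lra]. apply Hlub. intros t Et.
      apply Rnot_lt_le. intros H. apply Hno. now exists t. }
  pose proof (Hub t Et) as Htt. destruct Et as [Ht01 [N HN]].
  (* The midpoint lies beyond [tau] but inside interval [i], so moving from [t] to [t'] stays in
     [E]. As [tau] is the supremum, the cap 1 must be attained. *)
  set (t' := Rmin 1 ((tau + b i) / 2)).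
  assert (Ht'1 : t' <= 1) by apply Rmin_l.
  assert (Ht'b : t' <= (tau + b i) / 2) by apply Rmin_r.
  assert (Ht't : t <= t') by (apply Rmin_glb; lra).
  assert (Et' : E t').
  { split; [lra|]. exists (Nat.max N i).
    assert (H1 : sum_f_R0 (fun i => clamp i t - clamp i 0) N <=
                 sum_f_R0 (fun i => clamp i t - clamp i 0) (Nat.max N i)).
    { apply sum_f_R0_nonneg_le; [|lia]. intros j. apply Hmono; lra. }
    assert (H2 : clamp i t' - clamp i t <=
                 sum_f_R0 (fun i => clamp i t' - clamp i t) (Nat.max N i)).
    { apply (term_le_sum_f_R0 (fun i => clamp i t' - clamp i t)); [|lia].
      intros j. apply Hmono; lra. }
    rewrite !Hinside in H2 by lra.
    rewrite (sum_eq (fun i => clamp i t' - clamp i 0)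
               (fun i => (clamp i t' - clamp i t) + (clamp i t - clamp i 0)))
      by (intros; ring).
    rewrite sum_plus. lra. }
  assert (Hone : t' = 1).
  { pose proof (Hub t' Et') as H. unfold t' in *.
    destruct (Rle_dec 1 ((tau + b i) / 2)).
    - now apply Rmin_left.
    - rewrite Rmin_right in H by lra. lra. }
  rewrite Hone in Et'. destruct Et' as [_ [M HM]].
  apply Rle_trans with (1 := HM).
  apply Rle_trans with (sum_f_R0 (fun i => b i - a i) M).
  - apply sum_Rle. intros j _. unfold clamp.
    assert (Rmax (a j) (Rmin 1 (b j)) <= b j) by (apply Rmax_lub; [apply Hle | apply Rmin_r]).
    pose proof (Rmax_l (a j) (Rmin 0 (b j))). lra.
  - apply (growing_ineq (fun N => sum_f_R0 (fun i => b i - a i) N)); auto.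
    intros n. simpl. specialize (Hle (S n)). lra.
Qed.

(* The lower bound comes from covering the complementary preimage F^{-k}[0,u] efficiently. *)
Lemma lebesgue_measure_farey_preim (k : nat) (u m : R) :
  0 <= u <= 1 -> lebesgue_measure_is (farey_preim k u) m -> m = tail k u.
Proof.
  intros Hu [Hlow Hinf]. apply Rle_antisym.
  - destruct (list_cover_farey_preimage k u 1) as (l & Hl & HT); try lra.
    rewrite tail_1 in HT. apply le_epsilon. intros eps He. apply Hlow.
    replace (tail k u + eps) with (0 + total_length l + eps) by lra.
    apply interval_cover_subset with (fun x => False \/ farey_preim k u x); [auto|].
    apply interval_cover_list; auto using interval_cover_empty.
  - destruct (list_cover_farey_preimage k 0 u) as (l & Hl & HT); try lra.
    rewrite tail_0 in HT. apply Hinf. intros s Hs. apply le_epsilon. intros eps He.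
    assert (1 <= s + total_length l + eps); [|lra]. apply interval_cover_unit.
    eapply interval_cover_subset; [|apply interval_cover_list; eauto].
    intros x Hx. pose proof (farey_iter_bounds k x Hx). unfold farey_preim. simpl.
    destruct (Rle_dec u (farey_iter k x)); [left | right]; lra.
Qed.

(** * The renewal equation *)

(* Sum over [k < n], unlike [sum_f_R0], which runs over [k <= n]. *)
Fixpoint psum (f : nat -> R) (n : nat) : R :=
  match n with O => 0 | S m => psum f m + f m end.

Lemma psum_sum_f_R0 (f : nat -> R) (n : nat) : sum_f_R0 f n = psum f (S n).
Proof. induction n as [|n IH]; simpl in *; [ring | rewrite IH; ring]. Qed.

Lemma psum_le (f g : nat -> R) (n : nat) :
  (forall k, (k < n)%nat -> f k <= g k) -> psum f n <= psum g n.
Proof.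
  induction n as [|n IH]; intros H; simpl; [lra|].
  apply Rplus_le_compat; [apply IH; intros k Hk|]; apply H; lia.
Qed.

Lemma psum_eq (f g : nat -> R) (n : nat) :
  (forall k, (k < n)%nat -> f k = g k) -> psum f n = psum g n.
Proof. intros H. apply Rle_antisym; apply psum_le; intros k Hk; rewrite H; auto; lra. Qed.

Lemma psum_plus (f g : nat -> R) (n : nat) :
  psum (fun k => f k + g k) n = psum f n + psum g n.
Proof. induction n as [|n IH]; simpl; [|rewrite IH]; ring. Qed.

Lemma psum_scal (c : R) (f : nat -> R) (n : nat) :
  psum (fun k => c * f k) n = c * psum f n.
Proof. induction n as [|n IH]; simpl; [|rewrite IH]; ring. Qed.

Lemma psum_S_l (f : nat -> R) (n : nat) :
  psum f (S n) = f O + psum (fun k => f (S k)) n.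
Proof. induction n as [|n IH]; simpl in *; [|rewrite IH]; ring. Qed.

Lemma psum_nonneg (f : nat -> R) (n : nat) : (forall k, 0 <= f k) -> 0 <= psum f n.
Proof. intros H. induction n as [|n IH]; simpl; [lra|]. specialize (H n). lra. Qed.

(** For sequences decreasing together, (c k - c n)(d k - d n) >= 0; summing this over k < n gives
    the induction step. *)
Lemma chebyshev_sum (c d : nat -> R) (n : nat) :
  (forall i j, (i <= j)%nat -> c j <= c i) ->
  (forall i j, (i <= j)%nat -> d j <= d i) ->
  psum c n * psum d n <= INR n * psum (fun k => c k * d k) n.
Proof.
  intros Hc Hd. induction n as [|n IH]; [simpl; lra|].
  assert (H : psum (fun k => d n * c k + c n * d k) n <=
              psum (fun k => c k * d k + c n * d n) n).
  { apply psum_le. intros k Hk.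
    specialize (Hc k n ltac:(lia)). specialize (Hd k n ltac:(lia)).
    assert (0 <= (c k - c n) * (d k - d n)) by (apply Rmult_le_pos; lra). lra. }
  assert (Hcst : forall a, psum (fun _ => a) n = INR n * a).
  { clear. intros a. induction n as [|n IH]; [simpl; ring|].
    rewrite S_INR. cbn [psum]. rewrite IH. ring. }
  rewrite !psum_plus, !psum_scal, Hcst in H.
  rewrite S_INR. cbn [psum]. nra.
Qed.

(** A general [x] is kept for the induction: unfolding [tail (S n) (1 / x)] once leads to time [n]
    with [x + 1] and splits off the term k = n. *)
Lemma mass_decomposition (n : nat) (x : R) :
  0 < x ->
  1 - tail n (1 / x) =
  1 / (x + INR n) + psum (fun k => tail k (1 - / (x + INR (n - k)))) n.
Proof.
  revert x. induction n as [|n IH]; intros x Hx.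
  - simpl. field. lra.
  - cbn [psum]. rewrite S_INR.
    replace (S n - n)%nat with 1%nat by lia. cbn [tail].
    replace (1 / x / (1 + 1 / x)) with (1 / (x + 1)) by (field; lra).
    replace (1 / (1 + 1 / x)) with (1 - / (x + INR 1)) by (simpl; field; lra).
    specialize (IH (x + 1) ltac:(lra)).
    rewrite (psum_eq _ (fun k => tail k (1 - / (x + 1 + INR (n - k))))).
    + replace (x + (INR n + 1)) with (x + 1 + INR n) by ring. lra.
    + intros k Hk. f_equal. f_equal. f_equal.
      rewrite Nat.sub_succ_l, S_INR by lia. ring.
Qed.

(** The point 1 - 1/(1+j) = j/(j+1) is at least 1/2 because j >= 1, so [density_S_1] bounds the
    density there from below. *)
Lemma tail_gap_bounds (k j : nat) :
  (1 <= j)%nat ->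
  density (S k) 1 * (ln (INR j + 1) - ln (INR j))
    <= tail k (1 - / (1 + INR j))
    <= density k 1 * (ln (INR j + 1) - ln (INR j)).
Proof.
  intros Hj. assert (Hj' : 1 <= INR j) by (apply (le_INR 1); lia).
  replace (1 - / (1 + INR j)) with (INR j / (INR j + 1)) by (field; lra).
  assert (Hy : 1 / 2 <= INR j / (INR j + 1) < 1).
  { split; [apply -> Rle_div_r | apply <- Rlt_div_l]; lra. }
  assert (Hl : - ln (INR j / (INR j + 1)) = ln (INR j + 1) - ln (INR j)).
  { rewrite ln_div by lra. ring. }
  pose proof (tail_bounds k (INR j / (INR j + 1)) ltac:(lra)) as [H1 H2].
  rewrite Hl in H1, H2. split; [|exact H2].
  apply Rle_trans with (2 := H1). apply Rmult_le_compat_r.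
  - assert (ln (INR j) <= ln (INR j + 1)) by (apply ln_le; lra). lra.
  - rewrite density_S_1. apply density_le; lra.
Qed.

Lemma renewal_bounds (n : nat) :
  psum (fun k => density (S k) 1 * (ln (INR (n - k) + 1) - ln (INR (n - k)))) n
    <= 1 - / (INR n + 1)
    <= psum (fun k => density k 1 * (ln (INR (n - k) + 1) - ln (INR (n - k)))) n.
Proof.
  pose proof (mass_decomposition n 1 ltac:(lra)) as H.
  replace (1 / 1) with 1 in H by field. rewrite tail_1 in H.
  replace (1 / (1 + INR n)) with (/ (INR n + 1)) in H
    by (pose proof (pos_INR n); field; lra).
  replace (1 - / (INR n + 1)) with (psum (fun k => tail k (1 - / (1 + INR (n - k)))) n) by lra.
  split; apply psum_le; intros k Hk; apply tail_gap_bounds; lia.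
Qed.

(** * Summing the renewal inequalities over time *)

Definition log_conv (c : nat -> R) (n : nat) : R :=
  psum (fun k => c k * ln (INR (n - k) + 1)) n.

(** The renewal weights are differences of logarithms, so adding the convolutions over all times up
    to [n] telescopes to [log_conv]. In the term k = n the subtracted logarithm is ln 1 = 0. *)
Lemma log_conv_S (c : nat -> R) (n : nat) :
  log_conv c (S n) =
  log_conv c n + psum (fun k => c k * (ln (INR (S n - k) + 1) - ln (INR (S n - k)))) (S n).
Proof.
  unfold log_conv. cbn [psum]. rewrite Nat.sub_succ_l, Nat.sub_diag by lia.
  rewrite (psum_eq (fun k => c k * (_ - _))
             (fun k => c k * ln (INR (S n - k) + 1) + -1 * (c k * ln (INR (n - k) + 1)))).
  - rewrite psum_plus, psum_scal. change (INR 1) with 1. rewrite ln_1. ring.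
  - intros k Hk. rewrite (Nat.sub_succ_l k n), S_INR by lia. ring.
Qed.

Lemma ln_le_sub_1 (x : R) : 0 < x -> ln x <= x - 1.
Proof.
  intros Hx. pose proof (exp_ineq1_le (ln x)) as H. rewrite exp_ln in H by lra. lra.
Qed.

Lemma ln_succ_bounds (x : R) : 0 < x -> / (x + 1) <= ln (x + 1) - ln x <= / x.
Proof.
  intros Hx. rewrite <- ln_div by lra. split.
  - pose proof (ln_le_sub_1 (x / (x + 1)) ltac:(apply Rdiv_lt_0_compat; lra)) as H.
    rewrite ln_div in * by lra.
    replace (x / (x + 1) - 1) with (- / (x + 1)) in H by (field; lra). lra.
  - pose proof (ln_le_sub_1 ((x + 1) / x) ltac:(apply Rdiv_lt_0_compat; lra)) as H.
    replace ((x + 1) / x - 1) with (/ x) in H by (field; lra). lra.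
Qed.

Lemma log_conv_density_upper (n : nat) : log_conv (fun k => density (S k) 1) n <= INR n.
Proof.
  induction n as [|n IH]; [unfold log_conv; simpl; lra|].
  rewrite log_conv_S. destruct (renewal_bounds (S n)) as [H _].
  rewrite S_INR in *. pose proof (pos_INR n).
  assert (0 < / (INR n + 1 + 1)) by (apply Rinv_0_lt_compat; lra). lra.
Qed.

(** The defects 1/(m+1) of the renewal inequalities form a harmonic sum, at most ln(n+1). *)
Lemma log_conv_density_lower (n : nat) :
  INR n - ln (INR n + 1) <= log_conv (fun k => density k 1) n.
Proof.
  induction n as [|n IH].
  - unfold log_conv. simpl. rewrite Rplus_0_l, ln_1. lra.
  - rewrite log_conv_S. destruct (renewal_bounds (S n)) as [_ H].
    rewrite S_INR in *. pose proof (pos_INR n).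
    pose proof (ln_succ_bounds (INR n + 1) ltac:(lra)). lra.
Qed.

(** The sum is ln((n+1)!), so this is a one-sided Stirling bound. *)
Lemma log_factorial_lower (n : nat) :
  (INR n + 1) * ln (INR n + 1) - INR n <= psum (fun k => ln (INR (n - k) + 1)) n.
Proof.
  induction n as [|n IH].
  - simpl. rewrite Rplus_0_l, ln_1. lra.
  - rewrite psum_S_l. simpl Nat.sub. rewrite S_INR. pose proof (pos_INR n).
    pose proof (ln_succ_bounds (INR n + 1) ltac:(lra)) as [_ H1].
    assert ((INR n + 1) * / (INR n + 1) = 1) by (field; lra). nra.
Qed.

(** Densities at 1 and logarithmic weights both decrease in k, so by Chebyshev the product of their
    sums is at most n times [log_conv], hence at most n^2. The weights sum to at least n (ln(n+1) -
    1). *)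
Lemma density_sum_upper (n : nat) :
  (1 <= n)%nat ->
  psum (fun k => density (S k) 1) n * (ln (INR n + 1) - 1) <= INR n.
Proof.
  intros Hn. assert (1 <= INR n) by (apply (le_INR 1); lia).
  pose proof (chebyshev_sum (fun k => density (S k) 1) (fun k => ln (INR (n - k) + 1)) n) as H1.
  pose proof (log_conv_density_upper n) as H2. unfold log_conv in H2.
  pose proof (log_factorial_lower n) as H3.
  assert (HB : 0 <= psum (fun k => density (S k) 1) n)
    by (apply psum_nonneg; intros k; apply density_nonneg; lra).
  assert (H4 : 0 <= ln (INR n + 1)) by (rewrite <- ln_1; apply ln_le; lra).
  assert (H5 : psum (fun k => density (S k) 1) n * psum (fun k => ln (INR (n - k) + 1)) n
               <= INR n * INR n).
  { eapply Rle_trans; [apply H1|].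
    - intros i j Hij. apply density_1_antitone. lia.
    - intros i j Hij. pose proof (pos_INR (n - j)). apply ln_le; [lra|].
      apply Rplus_le_compat_r, le_INR. lia.
    - apply Rmult_le_compat_l; lra. }
  apply Rmult_le_reg_l with (INR n); [lra|].
  apply Rle_trans with (2 := H5).
  apply Rle_trans with
    (psum (fun k => density (S k) 1) n * ((INR n + 1) * ln (INR n + 1) - INR n)).
  - assert (0 <= psum (fun k => density (S k) 1) n * ln (INR n + 1))
      by (apply Rmult_le_pos; auto). nra.
  - apply Rmult_le_compat_l; auto.
Qed.

(** Every logarithmic weight is at most ln(n+1). *)
Lemma density_sum_lower (n : nat) :
  INR n - ln (INR n + 1) <= psum (fun k => density k 1) n * ln (INR n + 1).
Proof.
  apply Rle_trans with (1 := log_conv_density_lower n). unfold log_conv.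
  rewrite Rmult_comm, <- psum_scal. apply psum_le. intros k Hk. rewrite Rmult_comm.
  apply Rmult_le_compat_r; [apply density_nonneg; lra|].
  pose proof (pos_INR (n - k)). apply ln_le; [lra|].
  apply Rplus_le_compat_r, le_INR. lia.
Qed.

(* Since [farey_op] averages, the defect at 1/(m+1) is at most twice the next defect at 1/m plus a
   telescoping term. *)
Lemma density_defect_summable (m : nat) :
  exists K, forall n, psum (fun k => density k 1 - density k (/ (INR m + 1))) n <= K.
Proof.
  induction m as [|m [K HK]].
  - exists 0. intros n. simpl. rewrite Rplus_0_l, Rinv_1.
    induction n as [|n IH]; simpl; lra.
  (* The telescoping part contributes at most 2. The other is twice a defect sum at 1/(m+1) shifted
     by one index, and the missing first defect is nonnegative. *)
  - exists (2 + 2 * K). intros n.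
    assert (Hm : 0 < / (INR m + 1) <= 1).
    { pose proof (pos_INR m). split; [apply Rinv_0_lt_compat; lra|].
      rewrite <- Rinv_1. apply Rinv_le_contravar; lra. }
    set (x := / (INR m + 1)) in *.
    assert (Hx : / (INR (S m) + 1) = x / (1 + x)).
    { rewrite S_INR. unfold x. pose proof (pos_INR m). field. lra. }
    rewrite Hx.
    (* Bounding [density k (1 / (1 + x))] by [density k 1] in [E] gives the factor 1 + x <= 2. *)
    assert (Hstep : forall k,
      density k 1 - density k (x / (1 + x)) <=
      2 * (density k 1 - density (S k) 1) + 2 * (density (S k) 1 - density (S k) x)).
    { intros k. assert (E : density (S k) x * (1 + x) =
                            density k (x / (1 + x)) + x * density k (1 / (1 + x))).
      { change (density (S k) x) with (farey_op (density k) x). unfold farey_op.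
        field. lra. }
      destruct (branch_bounds x) as [[B1 B2] B3]; [lra|].
      assert (density k (1 / (1 + x)) <= density k 1) by (apply density_le; lra).
      assert (density (S k) x <= density (S k) 1) by (apply density_le; lra).
      pose proof (density_1_antitone k (S k) ltac:(lia)).
      nra. }
    eapply Rle_trans; [apply psum_le; intros k _; apply Hstep|].
    rewrite psum_plus, !psum_scal.
    assert (T : psum (fun k => density k 1 - density (S k) 1) n = 1 - density n 1).
    { clear. induction n as [|n IH]; [simpl; ring|]. cbn [psum]. rewrite IH. ring. }
    rewrite T. pose proof (density_nonneg n 1 ltac:(lra)).
    specialize (HK (S n)). rewrite psum_S_l in HK.
    assert (density 0 x <= density 0 1) by (apply density_le; lra). lra.
Qed.

(** * Final asymptotics *)

Lemma ln_sq_le (x : R) : 1 <= x -> ln x * ln x <= 4 * x.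
Proof.
  intros Hx. assert (Hs : 1 <= sqrt x) by (rewrite <- sqrt_1; apply sqrt_le_1; lra).
  assert (Hq : sqrt x * sqrt x = x) by (apply sqrt_sqrt; lra).
  assert (Hl : ln x = 2 * ln (sqrt x)).
  { rewrite <- Hq at 1. rewrite ln_mult by lra. ring. }
  assert (0 <= ln (sqrt x)) by (rewrite <- ln_1; apply ln_le; lra).
  pose proof (ln_le_sub_1 (sqrt x) ltac:(lra)). nra.
Qed.

Lemma two_le_ln (x : R) : 9 <= x -> 2 <= ln x.
Proof.
  intros Hx. rewrite <- (ln_exp 2). apply ln_le; [apply exp_pos|].
  replace 2 with (1 + 1) by ring. rewrite exp_plus.
  pose proof exp_le_3. pose proof (exp_pos 1). nra.
Qed.

(** For 1/(m+1) <= u the density on [u,1] is at least its value at 1/(m+1), whose total defect from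
    the value at 1 is bounded. *)
Lemma tail_sum_bounds (u : R) :
  0 < u < 1 ->
  exists K, forall n,
    - ln u * (psum (fun k => density k 1) n - K) <= psum (fun k => tail k u) n
      <= - ln u * psum (fun k => density k 1) n.
Proof.
  intros Hu. destruct (INR_unbounded (/ u)) as [m Hm].
  destruct (density_defect_summable m) as [K HK].
  exists K. intros n.
  assert (Hl : 0 < - ln u) by (pose proof (ln_increasing u 1); rewrite ln_1 in *; lra).
  assert (Hmu : 0 < / (INR m + 1) <= u).
  { assert (0 < / u) by (apply Rinv_0_lt_compat; lra). split.
    - apply Rinv_0_lt_compat; lra.
    - rewrite <- (Rinv_inv u). apply Rinv_le_contravar; lra. }
  split.
  - apply Rle_trans with (psum (fun k => - ln u * density k (/ (INR m + 1))) n).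
    + rewrite psum_scal. apply Rmult_le_compat_l; [lra|]. specialize (HK n).
      rewrite (psum_eq _ (fun k => density k 1 + -1 * density k (/ (INR m + 1)))) in HK
        by (intros; ring).
      rewrite psum_plus, psum_scal in HK. lra.
    + apply psum_le. intros k _. destruct (tail_bounds k u) as [H _]; [lra|].
      apply Rle_trans with (2 := H). rewrite Rmult_comm.
      apply Rmult_le_compat_r; [lra|]. apply density_le; lra.
  - rewrite <- psum_scal. apply psum_le. intros k _.
    destruct (tail_bounds k u) as [_ H]; lra.
Qed.

Lemma density_sum_asymptotics (n : nat) :
  (9 <= n)%nat ->
  INR n / ln (INR n) - 3 <= psum (fun k => density k 1) (S n)
    <= INR n / ln (INR n) + 1 + 2 * (INR n / (ln (INR n) * ln (INR n))).
Proof.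
  intros Hn. assert (Hx : 9 <= INR n) by (apply (le_INR 9) in Hn; simpl in Hn; lra).
  pose proof (density_sum_lower (S n)) as HL.
  pose proof (density_sum_upper n ltac:(lia)) as HU.
  rewrite S_INR in HL. rewrite psum_S_l in *.
  change (density 0 1) with 1 in *.
  set (B := psum (fun k => density (S k) 1) n) in *.
  assert (HB : 0 <= B) by (apply psum_nonneg; intros k; apply density_nonneg; lra).
  pose proof (two_le_ln (INR n) Hx) as H2.
  set (x := INR n) in *. set (L := ln x) in *.
  assert (H1 : L <= ln (x + 1)) by (apply ln_le; lra).
  split.
  - pose proof (ln_succ_bounds x ltac:(lra)) as [_ D1].
    pose proof (ln_succ_bounds (x + 1) ltac:(lra)) as [_ D2].
    fold L in D1. set (L2 := ln (x + 1 + 1)) in *.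
    assert (Hinv : / (x + 1) <= / x) by (apply Rinv_le_contravar; lra).
    assert (Hxi : x * / x = 1) by (field; lra).
    assert (HL2 : L2 <= L + 2 * / x) by lra.
    assert (Hxi1 : 0 <= / x <= / 2).
    { split; [apply Rlt_le, Rinv_0_lt_compat; lra|].
      apply Rinv_le_contravar; lra. }
    assert (HBx : B <= x).
    { apply Rle_trans with (2 := HU). rewrite <- (Rmult_1_r B) at 1.
      apply Rmult_le_compat_l; lra. }
    assert (HBi : B * / x <= 1).
    { rewrite <- Hxi. apply Rmult_le_compat_r; lra. }
    assert (H3 : (1 + B) * L2 <= (1 + B) * (L + 2 * / x))
      by (apply Rmult_le_compat_l; lra).
    (* Replacing ln(x+2) by [L] throughout costs at most L + 3, which is below 3 L since L >= 2. *)
    assert (x <= (1 + B + 3) * L) by lra.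
    assert (x / L <= 1 + B + 3) by (apply <- Rle_div_l; lra). lra.
  - assert (HBL : B * (L - 1) <= x) by nra.
    assert (B <= x / (L - 1)) by (apply -> Rle_div_r; lra).
    (* After multiplication by L - 1 the excess of the right side is x (L - 2) / L^2, nonnegative
       for L >= 2. *)
    assert (x / (L - 1) <= x / L + 2 * (x / (L * L))); [|lra].
    apply <- Rle_div_l; [|lra].
    replace ((x / L + 2 * (x / (L * L))) * (L - 1)) with (x + x * (L - 2) / (L * L))
      by (field; lra).
    assert (0 <= x * (L - 2) / (L * L)) by (apply Rdiv_le_0_compat; nra). lra.
Qed.

(* lam k = lambda(C_{k+1}^u) = lambda(F^{-k}[u,1]);
   sum_f_R0 lam n = sum_{k=0}^n lambda(C_{k+1}^u). *)
Theorem theorem2 (u : R) (hu : 0 < u < 1) :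
  exists (C : R) (N : nat),
    forall (n : nat) (lam : nat -> R),
      (N <= n)%nat ->
      (forall k, lebesgue_measure_is (farey_preim k u) (lam k)) ->
      Rabs (sum_f_R0 lam n - INR n * ln (1 / u) / ln (INR n))
        <= C * (INR n * ln (1 / u) / ln (INR n)) / ln (INR n).
Proof.
  destruct (tail_sum_bounds u hu) as [K HK].
  (* From n >= 9 follows ln n >= 2. With q = n / ln^2 n, bounded errors are absorbed by 1 <= 4 q:
     the lower error 3 + |K| costs at most (12 + 4 |K|) q and the upper error 1 + 2 q at most 6
     q. *)
  exists (14 + 4 * Rabs K), 9%nat. intros n lam Hn Hlam.
  assert (Hx : 9 <= INR n) by (apply (le_INR 9) in Hn; simpl in Hn; lra).
  pose proof (two_le_ln (INR n) Hx) as HL.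
  rewrite psum_sum_f_R0.
  rewrite (psum_eq lam (fun k => tail k u))
    by (intros k _; apply lebesgue_measure_farey_preim; auto; lra).
  specialize (HK (S n)). pose proof (density_sum_asymptotics n Hn) as HA.
  replace (ln (1 / u)) with (- ln u) by (rewrite ln_div, ln_1 by lra; ring).
  assert (Hl : 0 < - ln u) by (pose proof (ln_increasing u 1); rewrite ln_1 in *; lra).
  pose proof (ln_sq_le (INR n) ltac:(lra)) as Hsq.
  set (A := psum (fun k => density k 1) (S n)) in *.
  set (x := INR n) in *. set (L := ln x) in *. set (l := - ln u) in *.
  assert (Hq : 1 <= 4 * (x / (L * L))).
  { replace (4 * (x / (L * L))) with (4 * x / (L * L)) by (field; lra).
    apply -> Rle_div_r; nra. }
  replace (x * l / L) with (l * (x / L)) by (field; lra).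
  replace ((14 + 4 * Rabs K) * (l * (x / L)) / L)
    with (l * ((14 + 4 * Rabs K) * (x / (L * L)))) by (field; lra).
  set (q := x / (L * L)) in *. set (y := x / L) in *.
  pose proof (Rle_abs K). pose proof (Rabs_pos K).
  assert (Rabs K <= 4 * Rabs K * q) by nra.
  apply Rabs_le. split; nra.
Qed.
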